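(* Let $N\ge2$ be an integer and $x\in[0,1]\setminus\mathbb{Q}$. The sequences $\omega(x,N)$ and $\widehat\omega(x,N)$ have uniform word frequency. Moreover, every element of $X_{\omega(x,N)}$ and every element of $X_{\widehat\omega(x,N)}$ has uniform word frequency.
   Context: Let $N\ge 1$ be an integer and define $T_N:[0,1]\to[0,1]$ by $T_N(x)=\frac{N}{x}-\lfloor\frac{N}{x}\rfloor$ for $x\ne0$ and $T_N(0)=0$. For $x\in[0,1]\setminus\mathbb{Q}$ the (greedy) NCF digits of $x$ are $d_n=\lfloor N/T_N^{n-1}(x)\rfloor\ge N$, $n\ge1$; one writes $x=[0;d_1,d_2,\ldots]_N$. A substitution on $\{0,1\}$ is given by images of the letters (nonempty words) and extends to finite and infinite words by concatenation. For $x=[0;d_1,d_2,\ldots]_N$ irrational let $\sigma_n(0)=0^{d_n}1^N$, $\sigma_n(1)=0$ and $\widehat\sigma_n(0)=0^{d_n}1$, $\widehat\sigma_n(1)=0^N$ for $n\ge1$. The NCF sequence $\omega(x,N)\in\{0,1\}^{\mathbb N}$ is the unique infinite word $\omega$ for which there exist $\omega^{(1)},\omega^{(2)},\ldots\in\{0,1\}^{\mathbb{N}}$ with $\omega^{(1)}=\omega$ and $\omega^{(n)}=\sigma_n(\omega^{(n+1)})$ for all $n\ge1$. The dual NCF sequence $\widehat\omega(x,N)$ is defined in the same way with $\widehat\sigma_n$ in place of $\sigma_n$. $\{0,1\}^{\mathbb{N}}$ carries the product topology of the discrete topologies, $\Sigma$ is the left shift $\Sigma(\nu_0\nu_1\nu_2\cdots)=\nu_1\nu_2\cdots$,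 and for a sequence $\nu$, $X_\nu=\overline{\{\Sigma^n(\nu):n\in\mathbb{N}\}}$. For words $u,w$, $|w|_u$ denotes the number of occurrences of $u$ in $w$. A sequence $\nu=\nu_0\nu_1\cdots$ has uniform word frequency if for each finite word $u$ there exists $f_\nu(u)\in\mathbb{R}$, which does not depend on $k$, such that $\lim_{l\to\infty}\frac{|\nu_k\cdots\nu_{k+l-1}|_u}{l}=f_\nu(u)$ (for every $k\in\mathbb{N}$). *)

(* Defs.v *)
From HB Require Import structures.
From mathcomp Require Import all_boot all_order all_algebra.
From mathcomp Require Import all_classical all_reals all_analysis.
Set Implicit Arguments.
Unset Strict Implicit.
Unset Printing Implicit Defensive.
Import Order.TTheory GRing.Theory Num.Theory.
Import numFieldNormedType.Exports.
Local Open Scope classical_set_scope.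
Local Open Scope ring_scope.

(* The alphabet {0, 1} is bool, with 0 = false and 1 = true.  Infinite words  *)
(* are points of cantor_space, i.e. nat -> bool with the product topology.    *)

Definition ncf_map (R : realType) (N : nat) (x : R) : R :=
  if x == 0 then 0 else N%:R / x - (Num.floor (N%:R / x))%:~R.

(* Digits are indexed from 0: ncf_digit N x n is d_(n+1).                     *)
Definition ncf_digit (R : realType) (N : nat) (x : R) (n : nat) : nat :=
  `|Num.floor (N%:R / iter n (ncf_map N) x)|%N.

Definition substitution := bool -> seq bool.

Definition subst_word (s : substitution) (w : seq bool) : seq bool :=
  flatten (map s w).

(* For s with nonempty images, the image of the prefix of length i.+1 of v    *)
(* has length at least i.+1, so it determines the letter of index i.          *)
Definition subst_seq (s : substitution) (v : cantor_space) : cantor_space :=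
  fun i => nth false (subst_word s (mkseq v i.+1)) i.

Definition desubstitutable (s : nat -> substitution) : set cantor_space :=
  [set w | exists ws : nat -> cantor_space,
     ws 0%N = w /\ forall n, ws n = subst_seq (s n) (ws n.+1)].

Definition ncf_subst (R : realType) (N : nat) (x : R) (n : nat) : substitution :=
  fun a => if a then [:: false]
           else nseq (ncf_digit N x n) false ++ nseq N true.

Definition dual_ncf_subst (R : realType) (N : nat) (x : R) (n : nat) :
    substitution :=
  fun a => if a then nseq N false
           else rcons (nseq (ncf_digit N x n) false) true.

(* Definite descriptions; existence and uniqueness for N >= 1 and x irrational *)
(* in [0, 1] are ncf_seq_unique and dual_ncf_seq_unique below.                *)
Definition ncf_seq (R : realType) (N : nat) (x : R) : cantor_space :=
  get (desubstitutable (ncf_subst N x)).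

Definition dual_ncf_seq (R : realType) (N : nat) (x : R) : cantor_space :=
  get (desubstitutable (dual_ncf_subst N x)).

Definition left_shift (v : cantor_space) : cantor_space := fun i => v i.+1.

Definition orbit_closure (v : cantor_space) : set cantor_space :=
  closure (range (fun n => iter n left_shift v)).

(* Occurrences are counted with overlaps.                                     *)
Definition occurrences (u w : seq bool) : nat :=
  count (fun i => prefix u (drop i w)) (iota 0 (size w).+1).

Definition factor (v : cantor_space) (k l : nat) : seq bool :=
  mkseq (fun i => v (k + i)%N) l.

Definition uniform_word_frequency (R : realType) (v : cantor_space) : Prop :=
  forall u : seq bool, exists f : R, forall k : nat,
    (fun l : nat => (occurrences u (factor v k l))%:R / l%:R : R) @ \oo --> f.


Section directive.
Variable s : nat -> substitution.
Hypothesis s_head : forall n a, exists t, s n a = false :: t.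
Hypothesis s_size : forall n, (2 <= size (s n false))%N.

Let is_pref (u : seq bool) (v : cantor_space) := u = mkseq v (size u).

Let size_subst n w : (size w <= size (subst_word (s n) w))%N.
Proof.
elim: w => //= a w; rewrite /subst_word /= size_cat => IH.
by have [t ->] := s_head n a; rewrite /= addSn ltnS (leq_trans IH) ?leq_addl.
Qed.

Let subst_cat n u v :
  subst_word (s n) (u ++ v) = subst_word (s n) u ++ subst_word (s n) v.
Proof. by rewrite /subst_word map_cat flatten_cat. Qed.

Let mkseq_cat (v : nat -> bool) m p : (m <= p)%N ->
  mkseq v p = mkseq v m ++ map v (iota m (p - m)).
Proof.
by move=> mp; rewrite /mkseq -map_cat -[in LHS](subnKC mp) iotaD add0n.
Qed.

Let nth_stable n (v : nat -> bool) i m p :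
  (m <= p)%N -> (i < size (subst_word (s n) (mkseq v m)))%N ->
  nth false (subst_word (s n) (mkseq v p)) i =
  nth false (subst_word (s n) (mkseq v m)) i.
Proof. by move=> mp im; rewrite (mkseq_cat v mp) subst_cat nth_cat im. Qed.

Let pref_subst n u v :
  is_pref u v -> is_pref (subst_word (s n) u) (subst_seq (s n) v).
Proof.
rewrite /is_pref => uE.
apply: (@eq_from_nth _ false); rewrite ?size_mkseq// => i iu.
rewrite nth_mkseq// /subst_seq.
have ii : (i < size (subst_word (s n) (mkseq v i.+1)))%N.
  by apply: leq_trans (size_subst _ _); rewrite size_mkseq.
rewrite uE in iu *.
have [le|/ltnW le] := leqP (size u) i.+1.
  by rewrite [RHS](nth_stable le)// -uE.
by rewrite (nth_stable le).
Qed.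

Let Fixpoint W k n : seq bool :=
  if n is n'.+1 then subst_word (s k) (W k.+1 n') else [:: false].

Let W_head k n : exists t, W k n = false :: t.
Proof.
elim: n k => [|n IH] k; first by exists [::].
have [t /= ->] := IH k.+1; have [t' E] := s_head k false.
by rewrite /subst_word /= E; eexists.
Qed.

Let W_size k n : (n < size (W k n))%N.
Proof.
elim: n k => [//|n IH] k /=.
have := IH k.+1; have [t ->] := W_head k.+1 n.
rewrite /subst_word /= size_cat ltnS => nt.
have := s_size k; have := size_subst k t; rewrite /subst_word.
by move=> h1 h2; apply: (leq_trans _ (leq_add h2 h1)).
Qed.

Let W_prefS k n : prefix (W k n) (W k n.+1).
Proof.
elim: n k => [|n IH] k.
  by have [t ->] := W_head k 1; rewrite prefix_cons eqxx prefix0s.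
have /prefixP[t tE] := IH k.+1.
rewrite -[W k n.+2]/(subst_word (s k) (W k.+1 n.+1)) tE.
by rewrite subst_cat prefix_prefix.
Qed.

Let W_pref k n m : (n <= m)%N -> prefix (W k n) (W k m).
Proof.
elim: m => [|m IH]; first by rewrite leqn0 => /eqP ->; exact: prefix_refl.
rewrite leq_eqVlt => /orP[/eqP->|]; first exact: prefix_refl.
by rewrite ltnS => /IH h; exact: (prefix_trans h (W_prefS k m)).
Qed.

Let lim k : cantor_space := fun i => nth false (W k i) i.

Let W_nth k n m i : (n <= m)%N -> (i < size (W k n))%N ->
  nth false (W k m) i = nth false (W k n) i.
Proof. by move=> /(W_pref k) /prefixP[t ->] i_n; rewrite nth_cat i_n. Qed.

Let W_lim k n : is_pref (W k n) (lim k).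
Proof.
apply: (@eq_from_nth _ false); rewrite ?size_mkseq// => i i_n.
rewrite nth_mkseq// /lim; have [le|/ltnW le] := leqP n i.
  by rewrite (W_nth le).
by rewrite (W_nth le) ?W_size.
Qed.

Let pref_eq k (v v' : cantor_space) :
  (forall n, is_pref (W k n) v) -> (forall n, is_pref (W k n) v') -> v = v'.
Proof.
move=> h h'; apply: funext => i.
have /(congr1 (nth false ^~ i)) := etrans (esym (h i)) (h' i).
by rewrite !nth_mkseq ?W_size.
Qed.

Let lim_subst k : lim k = subst_seq (s k) (lim k.+1).
Proof.
have subst_pref n : is_pref (W k n.+1) (subst_seq (s k) (lim k.+1)).
  exact/pref_subst/W_lim.
apply: funext => i.
have ii : (i < size (W k i.+1))%N by exact: ltnW (W_size _ _).
have /(congr1 (nth false ^~ i)) := etrans (esym (W_lim k i.+1)) (subst_pref i).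
by rewrite !nth_mkseq.
Qed.

Lemma desubstitutable_unique : exists! w, desubstitutable s w.
Proof.
exists (lim 0%N); split; first by exists lim; split => // n; exact: lim_subst.
move=> w [ws [<- wsE]]; apply: (@pref_eq 0%N) => [n|]; first exact: W_lim.
move=> n; elim: n 0%N => [|n IH] k /=; last first.
  by rewrite wsE; exact/pref_subst/IH.
rewrite /is_pref /= /mkseq /= wsE /subst_seq /subst_word /=.
by have [t ->] := s_head k (ws k.+1 0%N).
Qed.

End directive.

Section digits.
Variables (R : realType) (N : nat).

Lemma ncf_map_irrational (x : R) : (0 < N)%N -> x \in `[0, 1] ->
  irrational x -> ncf_map N x \in `[0, 1] /\ irrational (ncf_map N x).
Proof.
move=> N0 _ ix; rewrite /ncf_map; case: eqP => [x0|/eqP x0].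
  by case: ix; exists 0 => //; rewrite x0 rmorph0.
split.
  rewrite in_itv /= subr_ge0 floor_le /=.
  by rewrite lerBlDl -[1]/(1%:~R) ltW// -intrD1 floorD1_gt.
move=> [q _ qE]; apply: ix.
have qxE : N%:R / x = ratr (q + (Num.floor (N%:R / x))%:~R).
  by rewrite rmorphD/= qE ratr_int subrK.
exists (N%:R / (q + (Num.floor (N%:R / x))%:~R)) => //.
rewrite rmorphM/= fmorphV/= ratr_nat -qxE invf_div mulrCA mulfV ?mulr1//.
by rewrite pnatr_eq0 -lt0n.
Qed.

Lemma ncf_digit_ge (x : R) n : (0 < N)%N -> x \in `[0, 1] ->
  irrational x -> (N <= ncf_digit N x n)%N.
Proof.
move=> N0 x01 ix; rewrite /ncf_digit.
have [] : iter n (ncf_map N) x \in `[0, 1] /\ irrational (iter n (ncf_map N) x).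
  by elim: n => //= n [? ?]; exact: ncf_map_irrational.
set y := iter _ _ _; rewrite in_itv/= => /andP[y0 y1] iy.
have {}y0 : 0 < y.
  rewrite lt_neqAle y0 andbT; apply/eqP => y0'.
  by case: iy; exists 0 => //; rewrite -y0' rmorph0.
have : (N%:Z <= Num.floor (N%:R / y))%R.
  by rewrite floor_ge_int ler_pdivlMr// ler_piMr// ler0n.
by case: (Num.floor _).
Qed.

Lemma ncf_seq_unique (x : R) : (0 < N)%N -> x \in `[0, 1] -> irrational x ->
  exists! w, desubstitutable (ncf_subst N x) w.
Proof.
move=> N0 x01 ix; apply: desubstitutable_unique => [n [|]|n] /=.
- by eexists.
- have := leq_trans N0 (ncf_digit_ge n N0 x01 ix).
  by case: ncf_digit => [//|d] _; eexists.
- rewrite size_cat !size_nseq.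
  exact: (@leq_add 1 1 _ _ (leq_trans N0 (ncf_digit_ge n N0 x01 ix)) N0).
Qed.

Lemma dual_ncf_seq_unique (x : R) : (0 < N)%N -> x \in `[0, 1] ->
  irrational x -> exists! w, desubstitutable (dual_ncf_subst N x) w.
Proof.
move=> N0 x01 ix; apply: desubstitutable_unique => [n [|]|n] /=.
- by case: N N0 => // M _; eexists.
- have := leq_trans N0 (ncf_digit_ge n N0 x01 ix).
  by case: ncf_digit => [//|d] _; eexists.
- rewrite size_rcons size_nseq ltnS.
  exact: leq_trans N0 (ncf_digit_ge _ N0 x01 ix).
Qed.

End digits.

(* Main.v *)
Require Import Defs.
From mathcomp Require Import all_boot all_order all_algebra.
From mathcomp Require Import all_classical all_reals all_analysis.
From mathcomp Require Import ring lra zify.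
Import Order.TTheory GRing.Theory Num.Theory.
Import numFieldNormedType.Exports.
Local Open Scope classical_set_scope.
Local Open Scope ring_scope.

(** Let A_n be the image of 0 under the composition of the first n
    substitutions.  For both sequences A_(n+2) = A_(n+1)^(d_(n+2)) A_n^N, and
    the sequence is, for every n, a concatenation of blocks A_n and A_(n+1).
    The number g(w) of occurrences of a fixed word in w is additive under
    concatenation up to a bounded error, so the ratio p_n = g(A_n)/|A_n|
    satisfies p_(n+2) = (weighted mean of p_(n+1) and p_n) + O(2^-n), where
    p_n has weight at most 1/3 because d_(n+2) >= N >= 2.  Hence
    |p_(n+2) - p_(n+1)| <= |p_(n+1) - p_n| / 3 + O(2^-n) and p_n converges to
    some f.  Cutting a long factor w into blocks A_n, A_(n+1), up to two
    boundary pieces, gives g(w)/|w| -> f uniformly in the position of w.  Points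
    of the orbit closure have only factors of the original sequence, so the same
    uniform limit applies to them. *)

(** * Cutting a concatenation of blocks at arbitrary positions *)

Lemma take_flatten_split {T : eqType} (bs : seq (seq T)) (M m : nat) :
  (forall b, b \in bs -> (size b <= M)%N) ->
  exists bs' t, [/\ take m (flatten bs) = flatten bs' ++ t,
    {subset bs' <= bs} & (size t <= M)%N].
Proof.
elim: bs m => [|b bs IH] m bM; first by exists [::], [::].
have [mb|bm] := ltnP m (size b).
  exists [::], (take m b); split => //=; first by rewrite take_cat mb.
  by rewrite size_take mb ltnW// (leq_trans mb)// bM ?mem_head.
have [c cbs|bs' [t [E sub tM]]] := IH (m - size b)%N.
  by rewrite bM// in_cons cbs orbT.
exists (b :: bs'), t; split => //=; first by rewrite take_cat ltnNge bm E catA.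
by move=> c; rewrite !in_cons => /orP[->//|/sub ->]; rewrite orbT.
Qed.

Lemma drop_flatten_split {T : eqType} (bs : seq (seq T)) (M m : nat) :
  (forall b, b \in bs -> (size b <= M)%N) ->
  exists t bs', [/\ drop m (flatten bs) = t ++ flatten bs',
    {subset bs' <= bs} & (size t <= M)%N].
Proof.
elim: bs m => [|b bs IH] m bM; first by exists [::], [::].
have [mb|bm] := ltnP m (size b).
  exists (drop m b), bs; split => //=; first by rewrite drop_cat mb.
    by move=> c cbs; rewrite in_cons cbs orbT.
  by rewrite size_drop (leq_trans (leq_subr _ _))// bM ?mem_head.
have [c cbs|t [bs' [E sub tM]]] := IH (m - size b)%N.
  by rewrite bM// in_cons cbs orbT.
exists t, bs'; split => //=; first by rewrite drop_cat ltnNge bm E.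
by move=> c /sub; rewrite in_cons => ->; rewrite orbT.
Qed.

Lemma infix_flatten_split {T : eqType} (w : seq T) (bs : seq (seq T)) (M : nat) :
  (forall b, b \in bs -> (size b <= M)%N) -> infix w (flatten bs) ->
  exists s bs' t, [/\ w = s ++ flatten bs' ++ t, {subset bs' <= bs},
    (size s <= M)%N & (size t <= M)%N].
Proof.
move=> bM /infixP[p [q E]].
have [bs1 [t [E1 sub1 tM]]] := take_flatten_split bs M (size p + size w)%N bM.
have /= wE : w = drop (size p) (flatten bs1 ++ t).
  by rewrite -E1 E catA take_size_cat ?size_cat// drop_size_cat.
have [pF|Fp] := ltnP (size p) (size (flatten bs1)).
  have [b /sub1 /bM//|s [bs2 [E2 sub2 sM]]] :=
    drop_flatten_split bs1 M (size p).
  exists s, bs2, t; split => //; last by move=> b /sub2 /sub1.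
  by rewrite wE drop_cat pF E2 catA.
(* Here [w] begins inside the incomplete last block [t], so [w] itself has length at most [M] and
   serves as the left piece. *)
rewrite drop_cat ltnNge Fp /= in wE.
exists w, [::], [::]; split; rewrite ?cats0//.
by rewrite wE size_drop (leq_trans (leq_subr _ _)).
Qed.

(** * Counting occurrences under concatenation *)

(** An occurrence in [a ++ b] starts in [b], lies within [a], or starts at one of the last [size u]
    positions of [a]. The extra 1 in the error is for empty [u], which [occurrences] also counts at
    the end of [a]. *)
Lemma occurrences_cat (u a b : seq bool) :
  (occurrences u (a ++ b) <= occurrences u a + occurrences u b + (size u).+1)%N /\
  (occurrences u a + occurrences u b <= occurrences u (a ++ b) + (size u).+1)%N.
Proof.
have E : occurrences u (a ++ b) =
    (count (fun i => prefix u (drop i a ++ b)) (iota 0 (size a)) + occurrences u b)%N.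
  rewrite /occurrences size_cat -addnS iotaD count_cat; congr addn.
    apply: eq_in_count => i; rewrite mem_iota => /= ia.
    by rewrite drop_cat ia.
  rewrite add0n -[X in iota X]addn0 iotaDl count_map; apply: eq_count => i /=.
  by rewrite drop_cat ltnNge leq_addr /= addKn.
have Ea : occurrences u a =
    (count (fun i => prefix u (drop i a)) (iota 0 (size a)) + (u == [::]))%N.
  rewrite /occurrences -addn1 iotaD count_cat add0n /= drop_size addn0.
  by case: u {E}.
have le1 : (count (fun i => prefix u (drop i a)) (iota 0 (size a)) <=
    count (fun i => prefix u (drop i a ++ b)) (iota 0 (size a)))%N.
  apply: sub_count => i /= /prefixP[t ->]; by rewrite -catA prefix_prefix.
have le2 : (count (fun i => prefix u (drop i a ++ b)) (iota 0 (size a)) <=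
    count (fun i => prefix u (drop i a)) (iota 0 (size a)) + size u)%N.
  apply: (@leq_trans (count (predU (fun i => prefix u (drop i a))
     (leq (size a - size u))) (iota 0 (size a)))).
    apply: sub_count => i /= h; have [iu|ui] := leqP (size a - size u) i.
      by rewrite orbT.
    move: h; rewrite !prefixE take_cat size_drop.
    have -> : (size u < size a - i)%N = true by apply/idP; lia.
    by move=> ->.
  have cnt : (count (leq (size a - size u)) (iota 0 (size a)) <= size u)%N.
    have := leq_subr (size u) (size a).
    set n := (size a - size u)%N => na; rewrite -(subnKC na) iotaD count_cat.
    rewrite (@eq_in_count _ _ pred0) ?count_pred0 ?add0n; last first.
      by move=> i; rewrite mem_iota /= add0n => ni; apply/negbTE; rewrite -ltnNge.
    by rewrite (leq_trans (count_size _ _))// size_iota /n; lia.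
  by rewrite -(leq_add2r (count (predI (fun i => prefix u (drop i a))
    (leq (size a - size u))) (iota 0 (size a)))) count_predUI; lia.
rewrite E Ea; case: eqP => _; lia.
Qed.

(** * Convergence criteria for real sequences *)

(** The telescoping series converges absolutely by comparison with a geometric series, and its
    partial sums are [p n - p 0]. *)
Lemma cvg_geometric_steps {R : realType} (p : nat -> R) (C : R) :
  (forall n, `|p n.+1 - p n| <= C / 2 ^+ n) -> cvgn p.
Proof.
move=> pC.
have /normed_cvg : cvgn [normed series (telescope p)].
  apply: (@series_le_cvg _ _ (geometric C 2^-1)) => //.
  - by move=> n; exact: normr_ge0.
  - by move=> n; rewrite /= exprVn; exact: le_trans (normr_ge0 _) (pC n).
  - by move=> n; rewrite /= exprVn; exact: pC.
  - by apply: is_cvg_geometric_series; rewrite normfV ger0_norm// invf_lt1// ltr1n.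
rewrite telescopeK => /cvg_ex[l pl]; apply/cvg_ex; exists (l + p 0%N).
rewrite -(eq_cvg _ _ (fun n => subrK (p 0%N) (p n))).
exact: (cvgD pl (cvg_cst (p 0%N))).
Qed.

Lemma contraction_cvg {R : realType} (p : nat -> R) (c : R) :
  (forall n, `|p n.+2 - p n.+1| <= `|p n.+1 - p n| / 3 + c / 2 ^+ n) -> cvgn p.
Proof.
(* The bound [C / 2 ^+ n] on the steps propagates as soon as [C / 3 + c <= C / 2], that is
   [6 * c <= C]; the other entry of the maximum starts the induction. *)
move=> pc; set C := Num.max (6 * c) `|p 1%N - p 0%N|.
apply: (cvg_geometric_steps p C); elim => [|n IH].
  by rewrite expr0 divr1 le_max lexx orbT.
have h6 : 6 * c <= C by rewrite le_max lexx.
have i2 : 0 < (2 ^+ n)^-1 :> R by rewrite invr_gt0 exprn_gt0.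
apply: (le_trans (pc n)); rewrite exprS invfM; nra.
Qed.

Lemma quasi_additive_flatten {R : realType} {T : eqType} (g : seq T -> R) (c : R)
    (bs : seq (seq T)) :
  (forall a b, `|g (a ++ b) - g a - g b| <= c) ->
  `|g (flatten bs) - \sum_(b <- bs) g b| <= c * (size bs).+1%:R.
Proof.
move=> gc; elim: bs => [|b bs IH] /=.
  (* Quasi-additivity on two empty words bounds [g [::]] by [c]; this accounts for the successor in
     [(size bs).+1]. *)
  have := gc [::] [::]; rewrite big_nil /= => h; rewrite -normrN subr0 mulr1.
  by apply: le_trans h; rewrite le_eqVlt; apply/orP; left; apply/eqP; congr `| _ |; ring.
rewrite big_cons.
have -> : g (b ++ flatten bs) - (g b + \sum_(j <- bs) g j) =
  (g (b ++ flatten bs) - g b - g (flatten bs)) +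
    (g (flatten bs) - \sum_(j <- bs) g j) by ring.
apply: (le_trans (ler_normD _ _)); apply: (le_trans (lerD (gc _ _) IH)).
by rewrite -[in leRHS]natr1 mulrDr mulr1 addrC.
Qed.

(** * Means of quasi-additive functions over words with a two-term block recurrence *)

Section recurrent_words.
Context {R : realType} {T : eqType}.
Variables (N : nat) (d : nat -> nat) (A : nat -> seq T).
Hypotheses (N2 : (2 <= N)%N) (dN : forall n, (N <= d n)%N).
Hypotheses (A0 : (0 < size (A 0))%N) (A1 : (2 * size (A 0) <= size (A 1))%N).
Hypothesis AE : forall n, A n.+2 = flatten (nseq (d n) (A n.+1) ++ nseq N (A n)).

Let sizeE n : size (A n.+2) = (d n * size (A n.+1) + N * size (A n))%N.
Proof.
by rewrite AE size_flatten /shape map_cat sumn_cat !map_nseq !sumn_nseq mulnC [(N * _)%N]mulnC.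
Qed.

Let size_double n : (2 * size (A n) <= size (A n.+1))%N.
Proof. case: n => // n; rewrite sizeE; have := dN n; nia. Qed.

Let size_ge_exp n : (2 ^ n <= size (A n))%N.
Proof.
elim: n => // n IH; rewrite expnS (leq_trans _ (size_double n))//.
by rewrite leq_mul2l IH.
Qed.

Variables (g : seq T -> R) (c K : R).
Hypothesis g_quasi_additive : forall a b, `|g (a ++ b) - g a - g b| <= c.

Let ratio n : R := g (A n) / (size (A n))%:R.

Let c_ge0 : 0 <= c.
Proof. exact: le_trans (normr_ge0 _) (g_quasi_additive [::] [::]). Qed.

Let ratio_step n :
  `|ratio n.+2 - ratio n.+1| <= `|ratio n.+1 - ratio n| / 3 + (3 * c) / 2 ^+ n.
Proof.
have a0 k : 0 < (size (A k))%:R :> R.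
  by rewrite ltr0n (leq_trans _ (size_ge_exp k))// expn_gt0.
have gE k : g (A k) = ratio k * (size (A k))%:R by rewrite /ratio divfK// gt_eqF.
have := quasi_additive_flatten g c (nseq (d n) (A n.+1) ++ nseq N (A n)) g_quasi_additive.
rewrite -AE size_cat !size_nseq big_cat/= !big_nseq -!Monoid.iteropE /= -!/(_ *+ _).
rewrite !gE sizeE.
have Nd : (N%:R : R) <= (d n)%:R by rewrite ler_nat.
have N2R : (2 : R) <= N%:R by rewrite ler_nat.
have ba : 2 * (size (A n))%:R <= (size (A n.+1))%:R :> R by rewrite -natrM ler_nat.
have eb : 2 ^+ n <= (size (A n.+1))%:R :> R.
  rewrite -natrX ler_nat (leq_trans _ (size_ge_exp n.+1))// leq_exp2l//.
have := a0 n; have := a0 n.+1; rewrite -[_.+1%:R]natr1 !natrD !natrM.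
rewrite -[_ * _ *+ d n]mulr_natl -[_ * _ *+ N]mulr_natl.
move: (ratio n.+2) (ratio n.+1) (ratio n) => p2 p1 p0.
move: {+}(d n)%:R {+}(N%:R : R) (size (A n.+1))%:R (size (A n))%:R Nd N2R ba eb.
move=> D M b a MD M2 ab eb b0 a0' E.
have e0 : 0 < 2 ^+ n :> R by rewrite exprn_gt0.
move: (2 ^+ n) e0 eb => e e0 eb.
(* [S] is the length of [A n.+2]; in the weighted mean, [p1] has weight [D * b / S] and [p0] has
   weight [M * a / S]. *)
set S := D * b + M * a in E *.
have S0 : 0 < S by rewrite /S; nra.
(* The contraction factor 1/3: [M <= D] and [2 * a <= b] give [2 * (M * a) <= D * b]. *)
have MS : 3 * (M * a) <= S.
  by rewrite /S; have := ler_pM _ _ MD ab; nra.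
have DS : D <= S / e by rewrite ler_pdivlMr// /S; nra.
rewrite -(ler_pM2r S0) -[X in _ * X <= _](gtr0_norm S0) -normrM.
have -> : (p2 - p1) * S = M * a * (p0 - p1) + (p2 * S - (D * (p1 * b) + M * (p0 * a))).
  by rewrite /S; ring.
apply: (le_trans (ler_normD _ _)); apply: (le_trans (lerD (lexx _) E)).
rewrite normrM (ger0_norm (x := M * a)) ?mulr_ge0//; [|lra|exact: ltW].
rewrite (distrC p0) mulrDl; apply: lerD.
  by have := normr_ge0 (p1 - p0); nra.
(* Joining [D + M] blocks costs at most [c * (D + M + 1)], and both [M] and 1 are at most [D]. *)
apply: (@le_trans _ _ (3 * c * D)).
  by have := c_ge0; nra.
have -> : 3 * c / e * S = 3 * c * (S / e) by ring.
by rewrite ler_wpM2l// mulr_ge0.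
Qed.

Lemma ratio_cvg : cvgn ratio.
Proof. exact: contraction_cvg ratio_step. Qed.

(** Each joined block costs an error [c]; spread over its at least [q] letters this is [c / q] per
    letter. The final [+ c] covers the empty concatenation. *)
Lemma quasi_additive_near_flatten (f delta q : R) (bs : seq (seq T)) : 0 < q ->
  (forall b, b \in bs -> q <= (size b)%:R) ->
  (forall b, b \in bs -> `|g b - f * (size b)%:R| <= delta * (size b)%:R) ->
  `|g (flatten bs) - f * (size (flatten bs))%:R| <=
    (delta + c / q) * (size (flatten bs))%:R + c.
Proof.
move=> q0; elim: bs => [|b bs IH] qb gb /=.
  have := g_quasi_additive [::] [::] => /=.
  by rewrite !mulr0 subr0 add0r addrAC subrr add0r normrN.
have {}IH : `|g (flatten bs) - f * (size (flatten bs))%:R| <=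
    (delta + c / q) * (size (flatten bs))%:R + c.
  by apply: IH => b' b'bs; [apply: qb|apply: gb]; rewrite in_cons b'bs orbT.
have {gb} := gb b (mem_head _ _); have {qb} := qb b (mem_head _ _).
have := g_quasi_additive b (flatten bs); rewrite size_cat natrD.
move: IH; set F := flatten bs; move: (size F)%:R (size b)%:R => sF sb.
move=> IH gbF qb gb.
have : c <= c / q * sb by rewrite mulrAC ler_pdivlMr// ler_wpM2l.
move: IH gbF gb; rewrite !ler_norml !mulrDl => /andP[? ?] /andP[? ?] /andP[? ?] ?.
apply/andP; split; lra.
Qed.

Hypothesis g_le : forall w, `|g w| <= K * (size w).+1%:R.

Lemma ratio_near (f eps : R) : ratio @ \oo --> f -> 0 < eps ->
  exists n, forall m, (n <= m)%N -> `|g (A m) - f * (size (A m))%:R| <=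
    eps * (size (A m))%:R.
Proof.
move=> /cvgrPdist_le rf /rf [n _ nP]; exists n => m nm.
have a0 : 0 < (size (A m))%:R :> R.
  by rewrite ltr0n (leq_trans _ (size_ge_exp m))// expn_gt0.
have -> : g (A m) - f * (size (A m))%:R = (ratio m - f) * (size (A m))%:R.
  by rewrite mulrBl /ratio divfK// gt_eqF.
by rewrite normrM (gtr0_norm a0) ler_pM2r// distrC nP.
Qed.

(** The mean is the limit of [ratio]. For given [eps] a single level [n] suffices: complete blocks
    contribute at most [eps / 2] per letter, and the remaining error is a constant absorbed by the
    length of [w]. As [L] is chosen before [w], the estimate is uniform in the position of a
    factor. *)
Lemma decomposable_mean : exists f : R, forall eps, 0 < eps ->
  exists L, forall w, (forall n, exists bs, {subset bs <= [:: A n; A n.+1]} /\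
      infix w (flatten bs)) ->
    (L <= size w)%N -> `|g w - f * (size w)%:R| <= eps * (size w)%:R.
Proof.
have /cvg_ex[f rf] := ratio_cvg; exists f => eps e0.
have [|n1 n1P] := ratio_near f (eps / 4) rf; first by rewrite divr_gt0.
have [n2 n2P] : exists n, c / 2 ^+ n <= eps / 4.
  (* Any [m] above [4 * c / eps] works because [m < 2 ^+ m]. *)
  exists (Num.truncn (4 * c / eps)).+1; set m := (Num.truncn _).+1.
  have : 4 * c / eps < m%:R by rewrite truncnS_gt.
  have : (m%:R : R) < 2 ^+ m by rewrite -natrX ltr_nat ltn_expl.
  rewrite ltr_pdivrMr// ler_pdivrMr ?exprn_gt0// => h1 h2.
  nra.
set n := maxn n1 n2; set M := size (A n.+1).
(* Two joins with the boundary pieces and the additive constant of the block estimate give [3 * c];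
   each boundary piece, of length at most [M], gives one copy of the bracket. *)
set C := 3 * c + 2 * (K * M.+1%:R + `|f| * M%:R).
exists (Num.truncn (2 * C / eps)).+1 => w /(_ n)[bs [bsA wbs]] Lw.
have nn1 : (n1 <= n)%N by rewrite leq_maxl.
have bM b : b \in bs -> (size b <= M)%N.
  move=> /bsA; rewrite !inE => /orP[|] /eqP -> //.
  by rewrite (leq_trans _ (size_double n))// leq_pmull.
have [s [bs' [t [wE sub sM tM]]]] := infix_flatten_split w bs M bM wbs.
have K0 : 0 <= K by have := g_le [::]; rewrite mulr1; exact: le_trans.
have piece u : (size u <= M)%N ->
    `|g u| <= K * M.+1%:R /\ `|f * (size u)%:R| <= `|f| * M%:R.
  move=> uM; split; first by rewrite (le_trans (g_le u))// ler_wpM2l// ler_nat ltnS.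
  by rewrite normrM ler_wpM2l// ger0_norm// ler_nat.
have near_flatten : `|g (flatten bs') - f * (size (flatten bs'))%:R| <=
    (eps / 4 + c / 2 ^+ n) * (size (flatten bs'))%:R + c.
  apply: quasi_additive_near_flatten; first by rewrite exprn_gt0.
    move=> b /sub /bsA; rewrite !inE -natrX ler_nat => /orP[|] /eqP ->.
      exact: size_ge_exp.
    by rewrite (leq_trans _ (size_ge_exp _))// leq_exp2l.
  move=> b /sub /bsA; rewrite !inE => /orP[|] /eqP ->; apply: n1P => //.
  exact: leqW.
have cn : c / 2 ^+ n <= eps / 4.
  apply: le_trans n2P; rewrite ler_wpM2l// lef_pV2 ?posrE ?exprn_gt0//.
  by rewrite ler_eXn2l ?ltr1n// leq_maxr.
have Cw : C <= eps / 2 * (size w)%:R.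
  have : 2 * C / eps < (size w)%:R.
    by apply: lt_le_trans (truncnS_gt _) _; rewrite ler_nat.
  by rewrite ltr_pdivrMr//; lra.
have Fw : (size (flatten bs'))%:R <= (size w)%:R :> R.
  by rewrite ler_nat wE !size_cat; lia.
have [gs fs] := piece s sM; have [gt ft] := piece t tM.
have := g_quasi_additive s (flatten bs' ++ t).
have := g_quasi_additive (flatten bs') t.
rewrite -wE; have -> : f * (size w)%:R =
    f * (size s)%:R + f * (size (flatten bs'))%:R + f * (size t)%:R.
  by rewrite wE !size_cat !natrD addrA !mulrDr.
have : (eps / 4 + c / 2 ^+ n) * (size (flatten bs'))%:R <= eps / 2 * (size w)%:R.
  by apply: ler_pM => //; rewrite ?addr_ge0 ?divr_ge0 ?exprn_ge0//; lra.
move: gs fs gt ft near_flatten Cw; rewrite /C !ler_norml.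
move: (K * M.+1%:R) (`|f| * M%:R) (f * (size s)%:R) (f * (size t)%:R).
move: (f * (size (flatten bs'))%:R) ((_ + _) * (size (flatten bs'))%:R).
move=> ? ? ? ? ? ? /andP[? ?] /andP[? ?] /andP[? ?] /andP[? ?] /andP[? ?] ? ?.
by move=> /andP[? ?] /andP[? ?]; apply/andP; split; lra.
Qed.
End recurrent_words.

(** * Block structure of desubstitutable sequences *)

Lemma flatten_nseq_flatten {T : Type} i j (w : seq T) :
  flatten (nseq i (flatten (nseq j w))) = flatten (nseq (i * j) w).
Proof. by elim: i => //= i ->; rewrite mulSn nseqD flatten_cat. Qed.

Lemma prefix_mkseq {T : eqType} (v : nat -> T) i l :
  (i <= l)%N -> prefix (mkseq v i) (mkseq v l).
Proof.
by move=> il; rewrite prefixE size_mkseq /mkseq -map_take take_iota (minn_idPl il).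
Qed.

Lemma infix_factor (v : cantor_space) k l w : prefix (mkseq v (k + l)%N) w ->
  infix (Defs.factor v k l) w.
Proof.
move=> /prefixP[t ->]; apply/infixP; exists (mkseq v k), t.
rewrite catA; congr cat; rewrite /mkseq iotaD map_cat; congr cat.
by rewrite add0n -[X in iota X l]addn0 iotaDl -map_comp.
Qed.

Section directive.
Variables (s : nat -> substitution) (m p : nat) (d : nat -> nat).
Hypotheses (sT : forall n, s n true = nseq m false)
  (sF : forall n, s n false = nseq (d n) false ++ nseq p true).
Hypotheses (m0 : (0 < m)%N) (d0 : forall n, (0 < d n)%N).

(** The substitution [s 0] is applied last, so [iter_subst n] carries a word of desubstitution level
    [n] back to level 0. *)
Fixpoint iter_subst n (w : seq bool) : seq bool :=
  if n is n'.+1 then iter_subst n' (subst_word (s n') w) else w.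

Lemma iter_subst_cat n a b : iter_subst n (a ++ b) = iter_subst n a ++ iter_subst n b.
Proof.
by elim: n a b => //= n IH a b; rewrite /subst_word map_cat flatten_cat IH.
Qed.

Lemma iter_subst_nseq n k a :
  iter_subst n (nseq k a) = flatten (nseq k (iter_subst n [:: a])).
Proof.
elim: k => [|k IH] /=; first by elim: n.
by rewrite -IH -iter_subst_cat.
Qed.

Lemma iter_subst_true n :
  iter_subst n.+1 [:: true] = flatten (nseq m (iter_subst n [:: false])).
Proof. by rewrite /= /subst_word /= cats0 sT iter_subst_nseq. Qed.

(** Each [true] produced by [s n.+1] becomes [m] blocks of level [n]. The NCF case is [m = 1],
    [p = N] and the dual case is [m = N], [p = 1], so both have the same multiplicity
    [p * m = N]. *)
Lemma iter_subst_rec n : iter_subst n.+2 [:: false] =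
  flatten (nseq (d n.+1) (iter_subst n.+1 [:: false]) ++
           nseq (p * m) (iter_subst n [:: false])).
Proof.
rewrite -[LHS]/(iter_subst n.+1 (subst_word (s n.+1) [:: false])).
have -> : subst_word (s n.+1) [:: false] = nseq (d n.+1) false ++ nseq p true.
  by rewrite /subst_word /= cats0 sF.
rewrite flatten_cat iter_subst_cat !(iter_subst_nseq n.+1).
by rewrite iter_subst_true flatten_nseq_flatten.
Qed.

Lemma iter_subst_blocks n w : exists bs,
  {subset bs <= [:: iter_subst n [:: false]; iter_subst n.+1 [:: false]]} /\
  iter_subst n.+1 w = flatten bs.
Proof.
elim: w => [|a w [bs [sub E]]]; first by exists [::]; split => //; exact: (iter_subst_nseq n.+1 0 false).
rewrite -(cat1s a w) iter_subst_cat E; case: a.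
  exists (nseq m (iter_subst n [:: false]) ++ bs); split.
    by move=> b; rewrite mem_cat => /orP[/nseqP[-> _]|/sub//]; rewrite mem_head.
  by rewrite iter_subst_true flatten_cat.
exists (iter_subst n.+1 [:: false] :: bs); split => // b.
by rewrite in_cons => /orP[/eqP ->|/sub//]; rewrite !inE eqxx orbT.
Qed.

Lemma size_subst_word n w : (size w <= size (subst_word (s n) w))%N.
Proof.
elim: w => //= a w; rewrite /subst_word /= size_cat => IH.
suff : (0 < size (s n a))%N by lia.
by case: a; rewrite ?sT ?sF ?size_cat !size_nseq // addn_gt0 d0.
Qed.

Lemma prefix_iter_subst n a b : prefix a b -> prefix (iter_subst n a) (iter_subst n b).
Proof. by move=> /prefixP[t ->]; rewrite iter_subst_cat prefix_prefix. Qed.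

Lemma prefix_subst_seq n v l :
  prefix (mkseq (subst_seq (s n) v) l) (subst_word (s n) (mkseq v l)).
Proof.
have lsz : (l <= size (subst_word (s n) (mkseq v l)))%N.
  by have := size_subst_word n (mkseq v l); rewrite size_mkseq.
rewrite prefixE size_mkseq; apply/eqP; apply: (@eq_from_nth _ false).
  by rewrite size_takel ?size_mkseq.
move=> i; rewrite size_takel// => il.
rewrite nth_take// nth_mkseq// /subst_seq.
(* [subst_seq] reads letter [i] from the image of the prefix of length [i.+1], which already has
   more than [i] letters since images of letters are nonempty. *)
have /prefixP[t ->] := prefix_mkseq v i.+1 l il.
rewrite /subst_word map_cat flatten_cat nth_cat.
have := size_subst_word n (mkseq v i.+1); rewrite size_mkseq.
by rewrite /subst_word => ->.
Qed.

Lemma prefix_desubstitution (ws : nat -> cantor_space) n l :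
  (forall n, ws n = subst_seq (s n) (ws n.+1)) ->
  prefix (mkseq (ws 0%N) l) (iter_subst n (mkseq (ws n) l)).
Proof.
move=> wsE; elim: n => [|n IH] /=; first exact: prefix_refl.
by apply: (prefix_trans IH); rewrite [X in mkseq X]wsE prefix_iter_subst ?prefix_subst_seq.
Qed.

Lemma factor_desubstitutable v k l n : desubstitutable s v ->
  exists bs, {subset bs <= [:: iter_subst n [:: false]; iter_subst n.+1 [:: false]]} /\
    infix (Defs.factor v k l) (flatten bs).
Proof.
move=> [ws [<- wsE]].
have [bs [sub E]] := iter_subst_blocks n (mkseq (ws n.+1) (k + l)%N).
by exists bs; split => //; rewrite -E; exact/infix_factor/prefix_desubstitution.
Qed.

End directive.

(** * Factors of points of the orbit closure *)

Lemma iter_left_shift n v i : iter n left_shift v i = v (n + i)%N.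
Proof. by elim: n i => //= n IH i; rewrite /left_shift IH addnS. Qed.

Lemma nbhs_mkseq (v : cantor_space) l :
  nbhs v [set w : cantor_space | mkseq w l = mkseq v l].
Proof.
elim: l => [|l IH]; first by apply: filterS filterT.
have vl : nbhs v [set w : cantor_space | w l = v l].
  have := @proj_continuous nat (fun=> bool) l v [set v l].
  by apply; exact: discrete_set1.
by apply: filterS2 IH vl => w /= wv wl; rewrite !mkseqS wv wl.
Qed.

Lemma orbit_closure_factor v v' k l : orbit_closure v v' ->
  exists k', Defs.factor v' k l = Defs.factor v k' l.
Proof.
(* The cylinder of length [k + l] around [v'] contains some shift of [v] by [n], so the factor of
   [v'] at [k] is that of [v] at [n + k]. *)
move=> /(_ _ (nbhs_mkseq v' (k + l)%N))[_ [[n _ <-]] /= E]; exists (n + k)%N.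
apply: (@eq_from_nth _ false); rewrite ?size_mkseq// => i il.
have kil : (k + i < k + l)%N by rewrite ltn_add2l.
have := congr1 (nth false ^~ (k + i)%N) E.
by rewrite !nth_mkseq// iter_left_shift addnA.
Qed.

(** * Uniform word frequencies *)

Lemma occurrences_quasi_additive {R : realType} (u a b : seq bool) :
  `|(occurrences u (a ++ b))%:R - (occurrences u a)%:R - (occurrences u b)%:R| <=
    (size u).+1%:R :> R.
Proof.
have [] := occurrences_cat u a b; rewrite -!(ler_nat R) !natrD => h1 h2.
by rewrite ler_norml; apply/andP; split; lra.
Qed.

(** Assuming only that factors of [v'] are factors of [v] treats [v] itself and the points of its
    orbit closure together. *)
Lemma uniform_word_frequency_factors {R : realType} (s : nat -> substitution)
    (m p : nat) (d : nat -> nat) (v v' : cantor_space) :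
  (forall n, s n true = nseq m false) ->
  (forall n, s n false = nseq (d n) false ++ nseq p true) ->
  (2 <= p * m)%N -> (forall n, (p * m <= d n)%N) ->
  desubstitutable s v ->
  (forall k l, exists k', Defs.factor v' k l = Defs.factor v k' l) ->
  uniform_word_frequency R v'.
Proof.
move=> sT sF pm dpm sv v'v u.
have m0 : (0 < m)%N by case: m pm {sT dpm} => //; rewrite muln0.
have d0 n : (0 < d n)%N by rewrite (leq_trans _ (dpm n))// ltnW.
have A1 : (2 * size (iter_subst s 0 [:: false]) <= size (iter_subst s 1 [:: false]))%N.
  rewrite /= /subst_word /= cats0 sF size_cat !size_nseq muln1.
  by rewrite (leq_trans pm)// (leq_trans (dpm 0%N))// leq_addr.
have [|f fP] := decomposable_mean (R := R) (p * m) (fun n => d n.+1)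
  (fun n => iter_subst s n [:: false]) pm (fun n => dpm n.+1) isT A1
  (iter_subst_rec s m p d sT sF) (fun w => (occurrences u w)%:R) (size u).+1%:R 1
  (occurrences_quasi_additive u).
  move=> w; rewrite mul1r ger0_norm// ler_nat /occurrences.
  by rewrite (leq_trans (count_size _ _))// size_iota.
exists f => k; apply/cvgrPdist_le => eps e0; have [L LP] := fP eps e0.
(* The successor keeps [l] positive, so that dividing by [l] is legitimate even when [L] is 0. *)
exists L.+1 => // l /= Ll; have l0 : 0 < l%:R :> R by rewrite ltr0n; case: l Ll.
have [k' ->] := v'v k l.
have {LP} := LP (Defs.factor v k' l); rewrite size_mkseq => LP.
have {}LP := LP (fun n => factor_desubstitutable s m p d sT sF m0 d0 v k' l n sv) (ltnW Ll).
rewrite distrC -(ler_pM2r l0) -[X in _ * X <= _](gtr0_norm l0) -normrM mulrBl.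
by rewrite divfK// gt_eqF.
Qed.

Theorem corollary5p16 (R : realType) (N : nat) (x : R)
    (hN : (2 <= N)%N) (hx01 : x \in `[0, 1]) (hx : irrational x) :
  [/\ uniform_word_frequency R (ncf_seq N x),
      uniform_word_frequency R (dual_ncf_seq N x),
      (forall v, orbit_closure (ncf_seq N x) v -> uniform_word_frequency R v) &
      (forall v, orbit_closure (dual_ncf_seq N x) v ->
         uniform_word_frequency R v)].
Proof.
have N0 : (0 < N)%N by exact: ltnW.
have digit_ge n := ncf_digit_ge n N0 hx01 hx.
have desub : desubstitutable (ncf_subst N x) (ncf_seq N x).
  by apply: getPex; have [w [sw _]] := ncf_seq_unique N0 hx01 hx; exists w.
have dual_desub : desubstitutable (dual_ncf_subst N x) (dual_ncf_seq N x).
  by apply: getPex; have [w [sw _]] := dual_ncf_seq_unique N0 hx01 hx; exists w.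
have freq v : (forall k l, exists k',
    Defs.factor v k l = Defs.factor (ncf_seq N x) k' l) -> uniform_word_frequency R v.
  apply: (uniform_word_frequency_factors _ 1 N (ncf_digit N x) _ _ _ _ _ _ desub);
    by rewrite ?muln1.
have dual_freq v : (forall k l, exists k',
    Defs.factor v k l = Defs.factor (dual_ncf_seq N x) k' l) ->
    uniform_word_frequency R v.
  apply: (uniform_word_frequency_factors _ N 1 (ncf_digit N x) _ _ _ _ _ _ dual_desub);
    by rewrite ?mul1n// => n; rewrite cats1.
split => [||v vP|v vP].
- by apply: freq => k l; exists k.
- by apply: dual_freq => k l; exists k.
- by apply: freq => k l; exact: orbit_closure_factor.
- by apply: dual_freq => k l; exact: orbit_closure_factor.
Qed.
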